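(* Let $K$ be an arbitrary commutative $\mathbf{k}$-algebra with identity. Then every finitely or countably generated Lie $K$-algebra can be embedded (by an injective homomorphism of Lie $K$-algebras) into a Lie $K$-algebra generated by two elements.
   Context: $\mathbf{k}$ is a field. *)

(* Defs.v *)
From HB Require Import structures.
From mathcomp Require Import all_boot all_order all_algebra.
Set Implicit Arguments. Unset Strict Implicit. Unset Printing Implicit Defensive.
Import GRing.Theory.
Local Open Scope ring_scope.

Record lieAlgType (R : comPzRingType) := LieAlg {
  lie_sort :> lmodType R;
  lie_br : lie_sort -> lie_sort -> lie_sort;
  lie_brlinl : forall (a : R) (x y z : lie_sort),
      lie_br (a *: x + y) z = a *: lie_br x z + lie_br y z;
  lie_brlinr : forall (a : R) (x y z : lie_sort),
      lie_br z (a *: x + y) = a *: lie_br z x + lie_br z y;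
  lie_bralt : forall x : lie_sort, lie_br x x = 0;
  lie_jacobi : forall x y z : lie_sort,
      lie_br x (lie_br y z) + lie_br y (lie_br z x) + lie_br z (lie_br x y) = 0
}.

Definition lie_closed (R : comPzRingType) (L : lieAlgType R) (P : L -> Prop) :=
  [/\ P 0,
      (forall x y, P x -> P y -> P (x + y)),
      (forall (c : R) x, P x -> P (c *: x)) &
      (forall x y, P x -> P y -> P (lie_br x y))].

Definition lie_generated_by (R : comPzRingType) (L : lieAlgType R) (S : L -> Prop) :=
  forall P : L -> Prop, lie_closed P -> (forall x, S x -> P x) -> forall x, P x.

(* finitely or countably generated: generated by the range of a sequence *)
Definition lie_countably_generated (R : comPzRingType) (L : lieAlgType R) :=
  exists g : nat -> L, lie_generated_by (fun x => exists n, x = g n).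

Definition lie_hom (R : comPzRingType) (L M : lieAlgType R) (f : L -> M) :=
  [/\ (forall (a : R) x y, f (a *: x + y) = a *: f x + f y) &
      (forall x y, f (lie_br x y) = lie_br (f x) (f y))].

(* Main.v *)
(* A Lie algebra over a commutative ring need not embed into an associative
   algebra, so the embedding uses only semidirect products of function algebras.
   For an alphabet X, the functions from words over X to L form a Lie algebra in
   which every letter acts as a derivation, and L sits in it as the functions
   supported on the empty word; any Lie algebra embeds into one where all its
   derivations are inner. With two letters e, z and the function f taking the
   value g_n on the word e^n z, one gets [z, ad(e)^n f] = g_n, while e and z kill
   L: thus three elements suffice. For two, take divided power series in y over
   the algebra so obtained, the derivation T = d/dy and
   b = f + y e + y^6/6! z. Then c = [T, b] = e + y^5/5! z and the y^i/i! z,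
   i <= 4, are generated, hence so are the y^i/i! ad(c)^n z, and a combination of
   their brackets with b, c and the y^j/j! z isolates (-1)^n g_n. *)

Require Import Defs.
From HB Require Import structures.
From mathcomp Require Import all_boot all_order all_algebra.
From mathcomp Require Import boolp functions.

Set Implicit Arguments. Unset Strict Implicit. Unset Printing Implicit Defensive.
Import GRing.Theory.
Local Open Scope ring_scope.

(* Cancels pairs [t], [- t] in a goal [s = 0]; each [t] must occur only once. *)
Ltac zmod_cancel :=
  rewrite -[LHS]add0r ?opprD ?opprK ?addrA;
  repeat match goal with |- context [- ?t] =>
    repeat rewrite (addrAC _ t); repeat rewrite (addrAC _ (- t)); rewrite addrK
  end.

(** * Linear maps and elementary bracket identities *)

Section LinearMaps.
Variables (R : pzRingType) (U V : lmodType R) (f : U -> V).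
Hypothesis flin : forall a x y, f (a *: x + y) = a *: f x + f y.

Lemma linmapD x y : f (x + y) = f x + f y.
Proof. by rewrite -[x]scale1r flin !scale1r. Qed.

Lemma linmap0 : f 0 = 0.
Proof. by apply: (addrI (f 0)); rewrite -linmapD !addr0. Qed.

Lemma linmapZ a x : f (a *: x) = a *: f x.
Proof. by rewrite -[a *: x]addr0 flin linmap0 addr0. Qed.

Lemma linmapN x : f (- x) = - f x.
Proof. by rewrite -scaleN1r linmapZ scaleN1r. Qed.

Lemma linmapB x y : f (x - y) = f x - f y.
Proof. by rewrite linmapD linmapN. Qed.

End LinearMaps.

Section LieTheory.
Variables (R : comPzRingType) (L : lieAlgType R).
Implicit Types x y z : L.

Let linl z := fun a x y => lie_brlinl (l:=L) a x y z.
Let linr z := fun a x y => lie_brlinr (l:=L) a x y z.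

Lemma lie_brDl x y z : lie_br (x + y) z = lie_br x z + lie_br y z.
Proof. exact: (linmapD (linl z)). Qed.
Lemma lie_brDr x y z : lie_br z (x + y) = lie_br z x + lie_br z y.
Proof. exact: (linmapD (linr z)). Qed.
Lemma lie_br0l z : lie_br 0 z = 0.
Proof. exact: (linmap0 (linl z)). Qed.
Lemma lie_br0r z : lie_br z 0 = 0.
Proof. exact: (linmap0 (linr z)). Qed.
Lemma lie_brNl x z : lie_br (- x) z = - lie_br x z.
Proof. exact: (linmapN (linl z)). Qed.
Lemma lie_brNr x z : lie_br z (- x) = - lie_br z x.
Proof. exact: (linmapN (linr z)). Qed.
Lemma lie_brZl (a : R) x z : lie_br (a *: x) z = a *: lie_br x z.
Proof. exact: (linmapZ (linl z)). Qed.
Lemma lie_brZr (a : R) x z : lie_br z (a *: x) = a *: lie_br z x.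
Proof. exact: (linmapZ (linr z)). Qed.

Lemma lie_skew x y : lie_br x y = - lie_br y x.
Proof.
apply/eqP; rewrite -addr_eq0; apply/eqP.
by have := lie_bralt (x + y); rewrite lie_brDl !lie_brDr !lie_bralt add0r addr0.
Qed.

Lemma lie_br_derivation x y z :
  lie_br x (lie_br y z) = lie_br (lie_br x y) z + lie_br y (lie_br x z).
Proof.
apply/eqP; rewrite -subr_eq0 opprD [lie_br (lie_br _ _) _]lie_skew opprK.
by rewrite [lie_br x z]lie_skew lie_brNr opprK addrA addrAC lie_jacobi.
Qed.

End LieTheory.

Definition lie_derivation (R : comPzRingType) (L : lieAlgType R) (D : L -> L) :=
  (forall (a : R) x y, D (a *: x + y) = a *: D x + D y) /\
  (forall x y, D (lie_br x y) = lie_br (D x) y + lie_br x (D y)).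

(** * Lie algebras cut out of modules by a predicate *)

Section SubLie.
Variables (R : comPzRingType) (V : lmodType R) (P : V -> Prop).
Hypotheses (P0 : P 0) (PD : forall x y, P x -> P y -> P (x + y)).
Hypothesis (PZ : forall (a : R) x, P x -> P (a *: x)).

(** Membership is made boolean by [asbool], so that the inclusion into [V] is injective. *)
Definition submodule := {x : V | `[< P x >]}.
HB.instance Definition _ := [isSub of submodule for @sval V (fun x => `[< P x >])].
HB.instance Definition _ := [Choice of submodule by <:].

Lemma submodule_closed : subsemimod_closed (fun x => `[< P x >]).
Proof.
split; first split; first exact/asboolP.
- by move=> x y /asboolP Px /asboolP Py; apply/asboolP/PD.
- by move=> a x /asboolP Px; apply/asboolP/PZ.
Qed.
HB.instance Definition _ :=
  GRing.SubChoice_isSubLmodule.Build R V (fun x => `[< P x >]) submodule submodule_closed.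

Variable br : V -> V -> V.
Hypothesis Pbr : forall x y, P x -> P y -> P (br x y).
Hypothesis brl : forall (a : R) x y z, P x -> P y -> P z ->
  br (a *: x + y) z = a *: br x z + br y z.
Hypothesis brr : forall (a : R) x y z, P x -> P y -> P z ->
  br z (a *: x + y) = a *: br z x + br z y.
Hypothesis bralt : forall x, P x -> br x x = 0.
Hypothesis brJ : forall x y z, P x -> P y -> P z ->
  br x (br y z) + br y (br z x) + br z (br x y) = 0.

(** The Lie axioms are assumed on [P] only, so that [V] may contain arbitrary maps while [P] selects
    the derivations. *)
Lemma sub_lie_algebra : exists (M : lieAlgType R) (i : M -> V),
  [/\ forall (a : R) x y, i (a *: x + y) = a *: i x + i y,
      forall x y, i (lie_br x y) = br (i x) (i y),
      injective i,
      forall m, P (i m) & forall v, P v -> exists m, i m = v].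
Proof.
have vP (x : submodule) : P (val x) by case: x => x Px; exact/asboolP.
pose b (x y : submodule) : submodule :=
  Sub (br (val x) (val y)) (introT (asboolP _) (Pbr (vP x) (vP y))).
have bE x y : val (b x y) = br (val x) (val y) by [].
have vlin (a : R) (x y : submodule) : val (a *: x + y) = a *: val x + val y.
  by rewrite linearP.
have v0 := linmap0 vlin.
have vD := linmapD vlin.
have bl (a : R) (x y z : submodule) : b (a *: x + y) z = a *: b x z + b y z.
  by apply: val_inj; rewrite bE !vlin brl // !bE.
have brr' (a : R) (x y z : submodule) : b z (a *: x + y) = a *: b z x + b z y.
  by apply: val_inj; rewrite bE !vlin brr // !bE.
have ba (x : submodule) : b x x = 0 by apply: val_inj; rewrite bE v0 bralt.
have bJ (x y z : submodule) : b x (b y z) + b y (b z x) + b z (b x y) = 0.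
  by apply: val_inj; rewrite v0 !vD !bE brJ.
exists (LieAlg bl brr' ba bJ), (fun x : submodule => val x); split => //.
by move=> v Pv; exists (Sub v (introT (asboolP _) Pv)).
Qed.

End SubLie.

(** It suffices that [a] and [b] generate at least the image of [L]: the target is then cut down to
    [G], the smallest closed predicate containing both. *)
Lemma generated_sub_lie_algebra (R : comPzRingType) (L W : lieAlgType R)
    (f : L -> W) (a b : W) :
  lie_hom f -> injective f ->
  (forall P, lie_closed P -> P a -> P b -> forall x, P (f x)) ->
  exists (M : lieAlgType R) (f' : L -> M),
    [/\ lie_hom f', injective f' &
        exists a b : M, lie_generated_by (fun x : M => x = a \/ x = b)].
Proof.
move=> [flin fbr] finj fgen.
pose G (x : W) := forall P, lie_closed P -> P a -> P b -> P x.
have G0 : G 0 by move=> P [].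
have GD x y : G x -> G y -> G (x + y).
  by move=> Gx Gy P cP Pa Pb; case: (cP) => _ + _ _; apply; [apply: Gx|apply: Gy].
have GZ (c : R) x : G x -> G (c *: x).
  by move=> Gx P cP Pa Pb; case: (cP) => _ _ + _; apply; apply: Gx.
have Gbr x y : G x -> G y -> G (lie_br x y).
  by move=> Gx Gy P cP Pa Pb; case: (cP) => _ _ _; apply; [apply: Gx|apply: Gy].
have [M [i [ilin ibr iinj iG Gi]]] := sub_lie_algebra G0 GD GZ Gbr
  (fun a x y z _ _ _ => lie_brlinl a x y z) (fun a x y z _ _ _ => lie_brlinr a x y z)
  (fun x _ => lie_bralt x) (fun x y z _ _ _ => lie_jacobi x y z).
have /choice [f' f'E] : forall x, exists m, i m = f x.
  by move=> x; apply: Gi => P cP Pa Pb; exact: fgen.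
have [a' a'E] : exists m, i m = a by apply: Gi.
have [b' b'E] : exists m, i m = b by apply: Gi.
exists M, f'; split.
- by split=> *; apply: iinj; rewrite ?ilin ?ibr !f'E ?flin ?fbr.
- by move=> x y e; apply: finj; rewrite -!f'E e.
exists a', b' => P [P0 PD PZ Pbr] Pab m.
(* [G] ranges over predicates on [W], so [P] is replaced by its image under [i]. *)
have : exists2 m', i m' = i m & P m'.
  apply: (iG m (fun w => exists2 m', i m' = w & P m')).
  - split.
    + by exists 0; rewrite // (linmap0 ilin).
    + by move=> _ _ [x <- Px] [y <- Py]; exists (x + y); [rewrite (linmapD ilin)|exact: PD].
    + by move=> c _ [x <- Px]; exists (c *: x); [rewrite (linmapZ ilin)|exact: PZ].
    + by move=> _ _ [x <- Px] [y <- Py]; exists (lie_br x y); [rewrite ibr|exact: Pbr].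
  - by exists a' => //; apply: Pab; left.
  - by exists b' => //; apply: Pab; right.
by case=> m' /iinj <-.
Qed.

(** * Semidirect product with the derivations *)

Lemma derivations_become_inner (R : comPzRingType) (N : lieAlgType R) :
  exists (W : lieAlgType R) (i : N -> W),
    [/\ lie_hom i, injective i &
        forall D, lie_derivation D -> exists t, forall x, lie_br t (i x) = i (D x)].
Proof.
(* A pair [(x, D)] stands for x + D in the semidirect product, where the bracket of [(0, D)] and
   [(x, 0)] is [(D x, 0)]. *)
pose V : lmodType R := (N * (N -> N))%type.
pose P (p : V) := lie_derivation p.2.
pose br (p q : V) : V :=
  (lie_br p.1 q.1 + p.2 q.1 - q.2 p.1, fun x => p.2 (q.2 x) - q.2 (p.2 x)).
have P0 : P 0.
  by split=> *; rewrite /= ?scaler0 ?lie_br0l ?lie_br0r addr0.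
have PD p q : P p -> P q -> P (p + q).
  case: p q => [x D] [y D'] [/= Dl Db] [/= D'l D'b]; split=> /=.
    by move=> a u v; rewrite /= !fctE Dl D'l scalerDr addrACA.
  by move=> u v; rewrite /= !fctE Db D'b lie_brDl lie_brDr addrACA.
have PZ (a : R) p : P p -> P (a *: p).
  case: p => [x D] [/= Dl Db]; split=> /=.
    by move=> c u v; rewrite /= !fctE Dl scalerDr !scalerA mulrC.
  by move=> u v; rewrite /= !fctE Db scalerDr lie_brZl lie_brZr.
have Pbr p q : P p -> P q -> P (br p q).
  case: p q => [x D] [y D'] [/= Dl Db] [/= D'l D'b]; split=> /=.
    move=> a u v; rewrite Dl D'l Dl D'l.
    by rewrite scalerBr opprD addrACA.
  move=> u v; rewrite Db D'b !(linmapD Dl, linmapD D'l) !Db !D'b.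
  rewrite !(lie_brDl, lie_brDr, lie_brNl, lie_brNr).
  apply/eqP; rewrite -subr_eq0; apply/eqP.
  by zmod_cancel.
have brl (a : R) p q r : P p -> P q -> P r ->
    br (a *: p + q) r = a *: br p r + br q r.
  move=> _ _ [rl _]; rewrite /br /=; congr pair.
    rewrite lie_brlinl rl !fctE [RHS]/= scalerBr scalerDr opprD.
    by rewrite (addrACA (_ *: _)) [LHS]addrACA.
  by apply/funext => x; rewrite !fctE rl /= !fctE scalerBr opprD addrACA.
have bra p : P p -> br p p = 0.
  move=> _; rewrite /br lie_bralt add0r subrr; congr pair.
  by apply/funext => x; rewrite subrr.
have brr (a : R) p q r : P p -> P q -> P r ->
    br r (a *: p + q) = a *: br r p + br r q.
  have brN u v : br u v = - br v u.
    rewrite /br /=; congr pair.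
      by rewrite lie_skew !opprD opprK addrAC.
    by apply/funext => x; rewrite /= !fctE opprB.
  by move=> Pp Pq Pr; rewrite brN brl // opprD -scalerN -!brN.
have brJ p q r : P p -> P q -> P r -> br p (br q r) + br q (br r p) + br r (br p q) = 0.
  case: p q r => [x D] [y D'] [z D''] [/= Dl Db] [/= D'l D'b] [/= D''l D''b].
  rewrite /br /=; congr pair; last first.
    apply/funext => u; rewrite /= !fctE !(linmapB Dl, linmapB D'l, linmapB D''l).
    by zmod_cancel.
  rewrite !(linmapB Dl, linmapB D'l, linmapB D''l, linmapD Dl, linmapD D'l, linmapD D''l).
  rewrite ?(linmapN Dl, linmapN D'l, linmapN D''l).
  rewrite Db D'b D''b !(lie_brDr, lie_brNr).
  (* Once oriented alike, the Leibniz terms cancel and the Jacobi identity of [N] remains. *)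
  rewrite (lie_skew (D y) z) (lie_skew (D' z) x) (lie_skew (D'' x) y).
  by zmod_cancel; rewrite add0r lie_jacobi.
have [W [j [jlin jbr jinj _ Pj]]] := sub_lie_algebra P0 PD PZ Pbr brl brr bra brJ.
have d0 : lie_derivation (0 : N -> N) by exact: P0.
have /choice [i iE] : forall x, exists m, j m = (x, 0) by move=> x; exact: Pj.
exists W, i; split.
- split=> *; apply: jinj; rewrite ?jlin ?jbr !iE /br /=; congr pair => /=.
  + by rewrite scaler0 addr0.
  + by rewrite subr0 addr0.
  + by apply/funext => u; rewrite /= subrr.
- by move=> x y e; have := iE x; rewrite e iE => -[].
- move=> D dD; have [t tE] : exists m, j m = (0, D) by exact: Pj.
  exists t => x; apply: jinj; rewrite jbr tE !iE /br /=; congr pair.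
    by rewrite lie_br0l add0r subr0.
  by apply/funext => u; rewrite /= (linmap0 dD.1) subrr.
Qed.

(** * Lie algebras of functions on words *)

Section Hurwitz.
Variables (R : comPzRingType) (L : lieAlgType R) (X : Type).
Implicit Types (F G H : seq X -> L) (w : seq X) (c : X).

Definition letter_shift c F : seq X -> L := fun w => F (c :: w).

(* Dual to the unshuffle coproduct on words: the bracket for which every
   [letter_shift c] is a derivation and evaluation at [[::]] is a homomorphism. *)
Fixpoint word_br w F G : L :=
  if w is c :: w' then word_br w' (letter_shift c F) G + word_br w' F (letter_shift c G)
  else lie_br (F [::]) (G [::]).

Lemma word_brlinl (a : R) F G H w :
  word_br w (a *: F + G) H = a *: word_br w F H + word_br w G H.
Proof.
elim: w F G H => [|c w IH] F G H /=; first exact: lie_brlinl.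
by rewrite [letter_shift c _](_ : _ = a *: letter_shift c F + letter_shift c G) // !IH
  scalerDr addrACA.
Qed.

Lemma word_brlinr (a : R) F G H w :
  word_br w H (a *: F + G) = a *: word_br w H F + word_br w H G.
Proof.
elim: w F G H => [|c w IH] F G H /=; first exact: lie_brlinr.
by rewrite [letter_shift c (_ + _)](_ : _ = a *: letter_shift c F + letter_shift c G) // !IH
  scalerDr addrACA.
Qed.

Lemma word_skew F G w : word_br w F G = - word_br w G F.
Proof.
elim: w F G => [|c w IH] F G /=; first exact: lie_skew.
by rewrite opprD addrC (IH F) (IH _ G).
Qed.

(** On a nonempty word the two Leibniz terms are opposite by skew-symmetry, so 2 need not be
    invertible. *)
Lemma word_bralt F w : word_br w F F = 0.
Proof.
case: w => [|c w] /=; first exact: lie_bralt.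
by rewrite word_skew addNr.
Qed.

Let br F G : seq X -> L := fun w => word_br w F G.

Lemma word_jacobi F G H w :
  word_br w F (br G H) + word_br w G (br H F) + word_br w H (br F G) = 0.
Proof.
elim: w F G H => [|c w IH] F G H /=; first exact: lie_jacobi.
have brD A B C : word_br w A (B + C) = word_br w A B + word_br w A C.
  by rewrite -[B]scale1r word_brlinr !scale1r.
have shbr A B : letter_shift c (br A B) = br (letter_shift c A) B + br A (letter_shift c B).
  by [].
rewrite !shbr !brD.
(* The nine Leibniz terms form three Jacobi sums on [w], each with one argument shifted. *)
rewrite -[RHS](addr0 0) -{1}(IH (letter_shift c F) G H) -[X in _ = _ + X](addr0 0).
rewrite -{1}(IH F (letter_shift c G) H) -(IH F G (letter_shift c H)).
apply/eqP; rewrite -subr_eq0; apply/eqP.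
by zmod_cancel.
Qed.

(** Over one letter these are the Hurwitz series, that is, divided power series over [L]. *)
Definition hurwitz : lieAlgType R.
refine (@LieAlg R (seq X -> L) br _ _ _ _).
- by move=> *; apply/funext => w; exact: word_brlinl.
- by move=> *; apply/funext => w; exact: word_brlinr.
- by move=> *; apply/funext => w; exact: word_bralt.
- by move=> *; apply/funext => w; exact: word_jacobi.
Defined.

Lemma letter_shift_derivation c : @lie_derivation R hurwitz (letter_shift c).
Proof. by []. Qed.

Definition empty_word_function (x : L) : hurwitz := fun w => if w is [::] then x else 0.

Lemma letter_shift_empty_word c x : letter_shift c (empty_word_function x) = 0.
Proof. by []. Qed.

Lemma empty_word_function_hom : lie_hom empty_word_function.
Proof.
split=> [a x y|x y]; apply/funext => -[|c w] //=.
  by rewrite /GRing.add /= /GRing.scale /= scaler0 addr0.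
rewrite /= /br /= !letter_shift_empty_word.
rewrite (linmap0 (fun a F G => word_brlinl a F G _ _)).
by rewrite (linmap0 (fun a F G => word_brlinr a F G _ _)) addr0.
Qed.

End Hurwitz.

Fixpoint letter_coding (R : comPzRingType) (L : lieAlgType R) (g : nat -> L)
    (n : nat) (w : seq bool) : L :=
  match w with
  | true :: w' => letter_coding g n.+1 w'
  | [:: false] => g n
  | _ => 0
  end.

(* The letters [true] and [false] act as [e] and [z], and [f] takes the value
   [g n] on the word [e^n z] and vanishes elsewhere. *)
Lemma sequence_from_three_elements (R : comPzRingType) (L : lieAlgType R) (g : nat -> L) :
  exists (W : lieAlgType R) (i : L -> W) (e z f : W),
    [/\ lie_hom i, injective i, forall n, lie_br z (iter n (lie_br e) f) = i (g n),
        forall x, lie_br e (i x) = 0 & forall x, lie_br z (i x) = 0].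
Proof.
have [W [j [[jlin jbr] jinj jder]]] := derivations_become_inner (hurwitz L bool).
have [e eE] := jder _ (letter_shift_derivation L true).
have [z zE] := jder _ (letter_shift_derivation L false).
have [elin ebr] := empty_word_function_hom L bool.
exists W, (fun x => j (empty_word_function x)), e, z, (j (letter_coding g 0)); split.
- by split=> *; rewrite ?elin ?jlin // ebr jbr.
- by move=> x y /jinj /(congr1 (fun F => F [::])).
(* The index of [letter_coding] counts the letters [true] already read, so a shift by [true] raises
   it by one. *)
- move=> n; have -> : iter n (lie_br e) (j (letter_coding g 0)) = j (letter_coding g n).
    by elim: n => //= n ->; rewrite eE.
  (* After [false], only the empty remainder gives a nonzero value, so the shift is the constant
     [g n]. *)
  by rewrite zE; congr j; apply/funext => -[|c w].
- by move=> x; rewrite eE letter_shift_empty_word (linmap0 jlin).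
- by move=> x; rewrite zE letter_shift_empty_word (linmap0 jlin).
Qed.

(** Both sides count pairs of disjoint subsets of sizes [i] and [j]. This gives the product rule for
    divided powers. *)
Lemma bin_trinomial m i j : ('C(m, i) * 'C(m - i, j) = 'C(m, i + j) * 'C(i + j, i))%N.
Proof.
have [le_m|lt_m] := leqP (i + j) m; last first.
  rewrite (bin_small lt_m); have [le_im|/bin_small->//] := leqP i m.
  by rewrite (@bin_small (m - i)) ?muln0 // ltn_subLR.
have le_im : (i <= m)%N := leq_trans (leq_addr j i) le_m.
have le_j : (j <= m - i)%N by rewrite leq_subRL.
have pos : (0 < i`! * j`! * (m - (i + j))`!)%N by rewrite !muln_gt0 !fact_gt0.
apply/eqP; rewrite -(eqn_pmul2r pos); apply/eqP.
transitivity m`!.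
  rewrite -(bin_fact le_im) -(bin_fact le_j) subnDA.
  by rewrite -!mulnA; congr (_ * _)%N; rewrite mulnCA !mulnA; congr (_ * _ * _)%N; rewrite mulnC.
rewrite -(bin_fact le_m) -(bin_fact (leq_addr j i)) addKn.
by rewrite -!mulnA.
Qed.

(** * Divided power series in one variable *)

Section DividedPowers.
Variables (R : comPzRingType) (L : lieAlgType R).
Notation H := (hurwitz L unit).
Notation T := (letter_shift tt).
Implicit Types (F G : H) (x y : L).

(* Over a one-letter alphabet, [F] is the series of the [F (nseq n tt) y^n/n!],
   and [divpow_mul i] is the multiplication by [y^i/i!]. *)
Definition divpow_mul (i : nat) F : H := fun w => F (drop i w) *+ 'C(size w, i).

Lemma divpow_mul0 F : divpow_mul 0 F = F.
Proof. by apply/funext => w; rewrite /divpow_mul drop0 bin0. Qed.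

Lemma divpow_mul_linear i (a : R) F G :
  divpow_mul i (a *: F + G) = a *: divpow_mul i F + divpow_mul i G.
Proof.
apply/funext => w; rewrite /divpow_mul.
by rewrite /GRing.add /= /GRing.scale /= mulrnDl scalerMnr.
Qed.

Lemma divpow_mulM i j F : divpow_mul i (divpow_mul j F) = divpow_mul (i + j) F *+ 'C(i + j, i).
Proof.
have MnE (G : H) n w : (G *+ n) w = G w *+ n.
  by elim: n => [|n IH]; rewrite ?mulr0n // !mulrS -IH.
apply/funext => w; rewrite MnE /divpow_mul drop_drop size_drop addnC -!mulrnA.
by rewrite [(_ * 'C(size w, i))%N]mulnC bin_trinomial.
Qed.

(** The Leibniz rule for d/dy, which on coefficients is Pascal's rule. *)
Lemma shift_divpow_mul i F : T (divpow_mul i.+1 F) = divpow_mul i F + divpow_mul i.+1 (T F).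
Proof.
apply/funext => w; rewrite /divpow_mul /letter_shift /= binS mulrnDr addrC.
rewrite /GRing.add /=; congr (_ + _).
(* The only letter is [tt], so [drop i w] is [tt :: drop i.+1 w] unless [w] is too short, and then
   the binomial vanishes. *)
have [lt_iw|le_wi] := ltnP i (size w); last by rewrite bin_small.
by rewrite (drop_nth tt lt_iw); case: (nth _ _ _).
Qed.

(** A series is determined by its constant term and its derivative; the induction on the word
    compares these by the Leibniz rule. *)
Lemma divpow_mul_br i F G : divpow_mul i (lie_br F G) = lie_br (divpow_mul i F) G.
Proof.
have brDl A B C w : word_br w (A + B : H) C = word_br w A C + word_br w B C.
  by have := lie_brDl (L:=H) A B C => /(congr1 (fun F => F w)).
apply/funext => w; elim: w i F G => [|[] w IH] [|i] F G.
- by rewrite !divpow_mul0.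
- by rewrite /divpow_mul /= /word_br !bin0n !mulr0n lie_br0l.
- by rewrite !divpow_mul0.
rewrite -/(letter_shift tt _ _) shift_divpow_mul.
rewrite [RHS]/= shift_divpow_mul brDl.
have := IH i.+1 (T F) G; have := IH i.+1 F (T G); have := IH i F G => /=.
move=> <- <- <-.
have -> : T (lie_br F G) = lie_br (T F : H) G + lie_br F (T G : H) by [].
by rewrite (linmapD (divpow_mul_linear i.+1)) addrA.
Qed.

Lemma divpow_mul_brr i F G : divpow_mul i (lie_br F G) = lie_br F (divpow_mul i G).
Proof.
by rewrite lie_skew (linmapN (divpow_mul_linear i)) divpow_mul_br -lie_skew.
Qed.

(** The series x y^i/i!. *)
Definition monomial i x : H := divpow_mul i (empty_word_function x).

Lemma shift_monomial0 x : T (monomial 0 x) = 0.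
Proof. by rewrite /monomial divpow_mul0. Qed.

Lemma shift_monomial i x : T (monomial i.+1 x) = monomial i x.
Proof.
by rewrite /monomial shift_divpow_mul letter_shift_empty_word
  (linmap0 (divpow_mul_linear _)) addr0.
Qed.

Lemma divpow_mul_monomial i x : divpow_mul i (monomial 0 x) = monomial i x.
Proof. by rewrite /monomial divpow_mul0. Qed.

Lemma monomial0_br x y : lie_br (monomial 0 x) (monomial 0 y) = monomial 0 (lie_br x y).
Proof. by rewrite /monomial !divpow_mul0 (empty_word_function_hom L unit).2. Qed.

Lemma monomial_0 i : monomial i 0 = 0.
Proof.
by rewrite /monomial (linmap0 (empty_word_function_hom L unit).1) (linmap0 (divpow_mul_linear _)).
Qed.

(** * Isolating the sequence from [b] and d/dy *)

Variables (e z f : L) (g : nat -> L).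
Hypothesis zef : forall n, lie_br z (iter n (lie_br e) f) = g n.
Hypotheses (eg : forall n, lie_br e (g n) = 0) (zg : forall n, lie_br z (g n) = 0).

Let b : H := monomial 0 f + monomial 1 e + monomial 6 z.
Let c : H := monomial 0 e + monomial 5 z.
Let Y n i : H := iter n (lie_br c) (monomial i z).

(** Closure under [T] stands for bracketing with the other generator, which acts as d/dy. *)
Lemma monomial_in_shift_generated (Q : H -> Prop) :
  lie_closed Q -> (forall F, Q F -> Q (T F)) -> Q b -> forall n, Q (monomial 0 (g n)).
Proof.
move=> [Q0 QD QZ Qbr] QT Qb n.
have TD F G : T (F + G) = T F + T G by [].
have QN F : Q F -> Q (- F) by rewrite -scaleN1r; exact: QZ.
(* Each derivative kills the constant term: [T b] is [c], and [T c] is y^4/4! z. *)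
have Qc : Q c.
  by move/QT: Qb; rewrite !TD !shift_monomial shift_monomial0 add0r.
have Q4 : Q (monomial 4 z).
  by move/QT: Qc; rewrite TD shift_monomial shift_monomial0 add0r.
have Q3 : Q (monomial 3 z) by rewrite -shift_monomial; exact: QT.
have Q2 : Q (monomial 2 z) by rewrite -shift_monomial; exact: QT.
have Q1 : Q (monomial 1 z) by rewrite -shift_monomial; exact: QT.
have Q0z : Q (monomial 0 z) by rewrite -shift_monomial; exact: QT.
have QY m i : Q (monomial i z) -> Q (Y m i).
  by move=> Qi; elim: m => //= m IH; exact: Qbr.
have YE m i : Y m i = divpow_mul i (Y m 0).
  elim: m => [|m IH]; first by rewrite [RHS]divpow_mul_monomial.
  by rewrite /= -/(Y m i) IH divpow_mul_brr.
have cg m : lie_br c (monomial 0 (g m)) = 0.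
  rewrite lie_brDl monomial0_br eg monomial_0 add0r -divpow_mul_monomial.
  by rewrite -divpow_mul_br monomial0_br zg monomial_0 (linmap0 (divpow_mul_linear _)).
(* The y^5/5! z part of [c] yields y^5/5! times a term of [g], which the next bracket with [c]
   kills; only the last such term survives. *)
have fE m : iter m (lie_br c) (monomial 0 f) = monomial 0 (iter m (lie_br e) f) +
    (if m is m'.+1 then monomial 5 (g m') else 0).
  elim: m => [|m IH]; first by rewrite addr0.
  rewrite iterS {}IH lie_brDr [X in _ + X](_ : _ = 0) ?addr0; last first.
    case: m => [|m]; first by rewrite lie_br0r.
    by rewrite -divpow_mul_monomial -divpow_mul_brr cg (linmap0 (divpow_mul_linear _)).
  rewrite lie_brDl monomial0_br; congr (_ + _).
  by rewrite -divpow_mul_monomial -divpow_mul_br monomial0_br zef divpow_mul_monomial.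
(* As [c] kills the values [g n], its action moves from the left argument to the right one at the
   cost of a sign. *)
have Yf m p : lie_br (Y m 0) (iter p (lie_br c) (monomial 0 f)) =
    (-1) ^+ m *: monomial 0 (g (m + p)%N).
  elim: m p => [|m IH] p.
    rewrite (_ : Y 0%N 0%N = monomial 0 z) // scale1r fE lie_brDr monomial0_br zef; case: p => [|p]; first by rewrite lie_br0r addr0.
    rewrite -(divpow_mul_monomial 5) -divpow_mul_brr monomial0_br zg monomial_0.
    by rewrite (linmap0 (divpow_mul_linear _)) addr0.
  have := lie_br_derivation c (Y m 0) (iter p (lie_br c) (monomial 0 f)).
  rewrite IH lie_brZr cg scaler0 -iterS IH.
  move/eqP; rewrite eq_sym addr_eq0 => /eqP ->.
  by rewrite exprS mulN1r scaleNr addnS.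
(* The exponent 6 makes the [y^6/6! [Y n 0, z]] terms cancel over the integers:
   1 - 'C(6, 1) + 'C(6, 3) - 'C(6, 2) = 0. *)
have key : lie_br (Y n 0) b - lie_br (Y n 1) c + lie_br (Y n 3) (monomial 3 z)
    - lie_br (Y n 2) (monomial 4 z) = (-1) ^+ n *: monomial 0 (g n).
  have := Yf n 0%N; rewrite addn0 => <-.
  rewrite (YE n 1%N) (YE n 2%N) (YE n 3%N) /b /c !lie_brDr /monomial.
  rewrite -!(divpow_mul_brr, divpow_mul_br) !divpow_mulM.
  rewrite -[(5 + 1)%N]/6%N -[(4 + 2)%N]/6%N -[(3 + 3)%N]/6%N.
  rewrite (_ : 'C(6, 5) = 6%N) // (_ : 'C(6, 4) = 15%N) // (_ : 'C(6, 3) = 20%N) //.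
  move: (divpow_mul 1 _) (divpow_mul 6 _) (divpow_mul 0 _) => A B C.
  (* The split 20 = 6 + 15 - 1 matches the multiples of [B] in the other brackets. *)
  have -> : B *+ 20 = B *+ 6 + B *+ 15 - B.
    by apply/eqP; rewrite eq_sym subr_eq -mulrnDr -mulrSr.
  by apply/eqP; rewrite -subr_eq0; apply/eqP; zmod_cancel.
have -> : monomial 0 (g n) = (-1) ^+ n *: ((-1) ^+ n *: monomial 0 (g n)).
  by rewrite scalerA -exprMn mulrNN mulr1 expr1n scale1r.
rewrite -key; apply: QZ.
by apply: (QD _ _ (QD _ _ (QD _ _ _ (QN _ _)) _) (QN _ _)); apply: Qbr => //; apply: QY.
Qed.

End DividedPowers.

Theorem theorem4p10 (k : fieldType) (K : comAlgType k) (L : lieAlgType K) :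
  lie_countably_generated L ->
  exists (M : lieAlgType K) (f : L -> M),
    [/\ lie_hom f, injective f &
        exists a b : M, lie_generated_by (fun x : M => x = a \/ x = b)].
Proof.
move=> [g gen].
have [W1 [i [e [z [f [[ilin ibr] iinj zef ei zi]]]]]] := sequence_from_three_elements g.
have [W [j [[jlin jbr] jinj jder]]] := derivations_become_inner (hurwitz W1 unit).
(* [t] acts as d/dy on the series; [t] and [j b] are the two generators. *)
have [t tE] := jder _ (letter_shift_derivation W1 tt).
have [elin ebr] := empty_word_function_hom W1 unit.
pose h x := j (empty_word_function (i x)).
pose b : hurwitz W1 unit := monomial 0 f + monomial 1 e + monomial 6 z.
apply: (@generated_sub_lie_algebra _ _ W h t (j b)).
- by split=> *; rewrite /h ?ilin ?elin ?jlin // ibr ebr jbr.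
- by move=> x y /jinj /(congr1 (fun F => F [::])) /iinj.
move=> P cP Pt Pb; have [P0 PD PZ Pbr] := cP.
(* The preimage of [P] under [h] is closed, so only the generators [g n] need checking. *)
apply: gen.
  rewrite /h; split.
  - by rewrite (linmap0 ilin) (linmap0 elin) (linmap0 jlin).
  - by move=> x y Px Py; rewrite (linmapD ilin) (linmapD elin) (linmapD jlin); exact: PD.
  - by move=> a x Px; rewrite (linmapZ ilin) (linmapZ elin) (linmapZ jlin); exact: PZ.
  - by move=> x y Px Py; rewrite ibr ebr jbr; exact: Pbr.
move=> _ [n ->].
(* The pullback of [P] along [j] is closed under d/dy because [P] contains [t]. *)
suff: (P \o j) (monomial 0 ((i \o g) n)) by rewrite /= /monomial divpow_mul0.
apply: (monomial_in_shift_generated zef (fun n => ei _) (fun n => zi _)) => //.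
- split=> /=.
  + by rewrite (linmap0 jlin).
  + by move=> F G PF PG; rewrite (linmapD jlin); exact: PD.
  + by move=> a F PF; rewrite (linmapZ jlin); exact: PZ.
  + by move=> F G PF PG; rewrite jbr; exact: Pbr.
- by move=> F PF; rewrite /= -tE; exact: Pbr.
Qed.
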